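(* Let $C$ be a spherical convex body in $S^n$ and let $0<\tau<\pi$. Then $C$ is of constant diameter $\tau$ if and only if $C$ is of constant width $\tau$.
   Context: $S^n$ is the unit sphere in $\mathbb{R}^{n+1}$, with origin $O$ and Euclidean inner product $\cdot$. The spherical distance of $P,Q\in S^n$ is $|PQ|=\arccos(\overrightarrow{OP}\cdot\overrightarrow{OQ})$. A set $K\subseteq S^n$ is spherically convex if the cone $\{\lambda u:\lambda>0,u\in K\}$ is convex in $\mathbb{R}^{n+1}$. A spherical convex body is a closed, spherically convex subset of $S^n$ with nonempty interior relative to $S^n$. The boundary of $K$ relative to $S^n$ is denoted $\partial K$. For $P\in S^n$, the closed hemisphere centered at $P$ is $S^+_P=\{Q\in S^n:\overrightarrow{OP}\cdot\overrightarrow{OQ}\ge 0\}$. If $K\subseteq S^+_Q$ and some boundary point $P\in\partial K$ lies on the boundary great sphere $\{R\in S^n:\overrightarrow{OQ}\cdot\overrightarrow{OR}=0\}$ of $S^+_Q$, then $S^+_Q$ is called a supporting hemisphere of $K$ at $P$. If $S^+_P\neq S^+_Q$ and the two hemispheres are not opposite, then $S^+_P\cap S^+_Q$ is called a lune, and its thickness is $\Delta(S^+_P\cap S^+_Q)=\pi-|PQ|$. For a supporting hemisphere $S^+_P$ of a spherical convex body $K$, the width of $K$ with respect to $S^+_P$ is $\mathrm{width}_{S^+_P}(K)=\min\{\Delta(S^+_P\cap S^+_Q): K\subset S^+_Q\}$. The body $K$ is of constant width $\tau$ if $\mathrm{width}_{S^+_P}(K)=\tau$ for every supporting hemisphere $S^+_P$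 of $K$. The diameter of $K$ is $\max\{|PQ|:P,Q\in K\}$. The body $K$ is of constant diameter $\tau$ if its diameter is $\tau$ and, for every $P\in\partial K$, there is $Q\in K$ with $|PQ|=\tau$. *)

(* Defs.v *)
From Stdlib Require Import Reals Lra.
Open Scope R_scope.

(* Points of R^{n+1} are represented as functions nat -> R; only the
   coordinates 0..n are relevant (the sphere requires the others to be 0). *)
Definition vec := nat -> R.

Definition dot (n : nat) (x y : vec) : R := sum_f_R0 (fun i => x i * y i) n.

Definition sphere (n : nat) (x : vec) : Prop :=
  (forall i, (n < i)%nat -> x i = 0) /\ dot n x x = 1.

Definition sdist (n : nat) (P Q : vec) : R := acos (dot n P Q).

Definition cone (K : vec -> Prop) (v : vec) : Prop :=
  exists (l : R) (u : vec), 0 < l /\ K u /\ forall i, v i = l * u i.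

Definition sph_convex (n : nat) (K : vec -> Prop) : Prop :=
  (forall x, K x -> sphere n x) /\
  forall a b t, cone K a -> cone K b -> 0 <= t <= 1 ->
    cone K (fun i => t * a i + (1 - t) * b i).

Definition sph_interior_pt (n : nat) (K : vec -> Prop) (P : vec) : Prop :=
  sphere n P /\ exists eps, 0 < eps /\
    forall Q, sphere n Q -> sdist n P Q < eps -> K Q.

Definition sph_closed (n : nat) (K : vec -> Prop) : Prop :=
  forall P, sphere n P ->
    (forall eps, 0 < eps -> exists Q, K Q /\ sdist n P Q < eps) -> K P.

Definition sph_boundary (n : nat) (K : vec -> Prop) (P : vec) : Prop :=
  sphere n P /\
  forall eps, 0 < eps ->
    (exists Q, K Q /\ sdist n P Q < eps) /\
    (exists Q, sphere n Q /\ ~ K Q /\ sdist n P Q < eps).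

Definition sph_convex_body (n : nat) (K : vec -> Prop) : Prop :=
  sph_convex n K /\ sph_closed n K /\ exists P, sph_interior_pt n K P.

Definition hemi (n : nat) (P : vec) (Q : vec) : Prop :=
  sphere n Q /\ 0 <= dot n P Q.

Definition supporting_hemi_at (n : nat) (K : vec -> Prop) (Q P : vec) : Prop :=
  sphere n Q /\ (forall R, K R -> hemi n Q R) /\
  sph_boundary n K P /\ dot n Q P = 0.

Definition supporting_hemi (n : nat) (K : vec -> Prop) (Q : vec) : Prop :=
  exists P, supporting_hemi_at n K Q P.

(* S^+_P and S^+_Q are neither equal nor opposite, so S^+_P ∩ S^+_Q is a lune. *)
Definition is_lune (n : nat) (P Q : vec) : Prop :=
  ~ (forall R, hemi n P R <-> hemi n Q R) /\
  ~ (forall R, hemi n Q R <-> (sphere n R /\ dot n P R <= 0)).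

Definition thickness (n : nat) (P Q : vec) : R := PI - sdist n P Q.

Definition width_eq (n : nat) (K : vec -> Prop) (P : vec) (w : R) : Prop :=
  (exists Q, sphere n Q /\ is_lune n P Q /\ (forall R, K R -> hemi n Q R) /\
             thickness n P Q = w) /\
  (forall Q, sphere n Q -> is_lune n P Q -> (forall R, K R -> hemi n Q R) ->
             w <= thickness n P Q).

Definition constant_width (n : nat) (K : vec -> Prop) (tau : R) : Prop :=
  forall P, sphere n P -> supporting_hemi n K P -> width_eq n K P tau.

Definition diameter_eq (n : nat) (K : vec -> Prop) (d : R) : Prop :=
  (exists P Q, K P /\ K Q /\ sdist n P Q = d) /\
  (forall P Q, K P -> K Q -> sdist n P Q <= d).

Definition constant_diameter (n : nat) (K : vec -> Prop) (tau : R) : Prop :=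
  diameter_eq n K tau /\
  forall P, sph_boundary n K P -> exists Q, K Q /\ sdist n P Q = tau.

(* Main.v *)
(* Write c = cos tau, s = sin tau, and let K* be the polar body of those P with
   P.k >= 0 for all k in K. Supporting hemispheres of K are centred at the points
   P of K* with P.p = 0 for some p in K, so constant width tau of K says that K* has
   constant diameter pi - tau. As K** = K, it is enough to show that K* has constant
   diameter pi - tau when K has constant diameter tau.

   For p in K and P in K* with P.p = 0, the point y = c p + s P lies in K: a path in
   {x : x.k > c for all k in K} that starts in K never meets the boundary of K, where
   x.k = c for some k. If c < 0, such a path leads from a point of K to P and then to
   every x with x.P >= s. If c >= 0, such paths show that K is the intersection of the
   balls of radius tau centred in K; were y.k < c for some k in K, then that
   intersection would contain points near p outside the hemisphere of P.
   First-order minimality of p at y puts (p - c y)/s in K*, at inner product -c with P. *)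
Require Import Defs.
From Stdlib Require Import Reals Lra Lia Classical FunctionalExtensionality.
Open Scope R_scope.

(** * Inner products, normalization and cones *)

(** Scalar multiples are written [comb a x 0 x], so that bilinearity in [comb] covers all vector
    arithmetic. *)
Definition comb (a : R) (x : vec) (b : R) (y : vec) : vec :=
  fun i => a * x i + b * y i.

Definition supp (n : nat) (x : vec) : Prop := forall i, (n < i)%nat -> x i = 0.

Definition polar (n : nat) (K : vec -> Prop) (w : vec) : Prop :=
  sphere n w /\ forall k, K k -> 0 <= dot n w k.

Lemma dot_sym n x y : dot n x y = dot n y x.
Proof. unfold dot; apply sum_eq; intros; ring. Qed.

Lemma dot_comb_l n a x b y z :
  dot n (comb a x b y) z = a * dot n x z + b * dot n y z.
Proof.
  unfold dot, comb.
  induction n as [|n IH]; simpl; [ring | rewrite IH; ring].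
Qed.

Lemma dot_comb_r n a x b y z :
  dot n z (comb a x b y) = a * dot n z x + b * dot n z y.
Proof. rewrite dot_sym, dot_comb_l, (dot_sym n x), (dot_sym n y); ring. Qed.

Lemma supp_comb n a x b y : supp n x -> supp n y -> supp n (comb a x b y).
Proof.
  intros Hx Hy i Hi; unfold comb; rewrite (Hx i Hi), (Hy i Hi); ring.
Qed.

Lemma dot_pos n x : 0 <= dot n x x.
Proof. unfold dot; apply cond_pos_sum; intros; nra. Qed.

Lemma coord_sq_le n x i : (i <= n)%nat -> x i * x i <= dot n x x.
Proof.
  induction n as [|n IH]; intros Hi.
  - replace i with 0%nat by lia; unfold dot; simpl; lra.
  - unfold dot in *; simpl. destruct (Nat.eq_dec i (S n)) as [->|Hne].
    + assert (0 <= sum_f_R0 (fun i => x i * x i) n) by (apply (dot_pos n x)). lra.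
    + assert (x i * x i <= sum_f_R0 (fun i => x i * x i) n) by (apply IH; lia). nra.
Qed.

Lemma supp_dot0 n x : supp n x -> dot n x x = 0 -> forall i, x i = 0.
Proof.
  intros Hs H i. destruct (Compare_dec.le_lt_dec i n) as [Hi|Hi]; [|now apply Hs].
  pose proof (coord_sq_le n x i Hi). nra.
Qed.

Lemma cauchy_schwarz n x y : dot n x y * dot n x y <= dot n x x * dot n y y.
Proof.
  pose proof (dot_pos n (comb (dot n y y) x (- dot n x y) y)) as H.
  pose proof (dot_pos n (comb (dot n x y) x (- (dot n x x + 1)) y)) as H1.
  rewrite !dot_comb_l, !dot_comb_r, (dot_sym n y x) in H, H1.
  pose proof (dot_pos n x) as Hx. pose proof (dot_pos n y) as Hy.
  set (A := dot n x x) in *. set (B := dot n x y) in *. set (D := dot n y y) in *.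
  destruct (Rle_lt_or_eq_dec 0 D Hy) as [E|E].
  - assert (0 <= D * (A * D - B * B)) by lra.
    assert (0 <= A * D - B * B); [|lra].
    apply (Rmult_le_reg_l D); [exact E | rewrite Rmult_0_r; exact H0].
  (* With D = 0, [H1] reads 0 <= - (A + 2) B^2, which forces B = 0. *)
  - rewrite <- E in *. nra.
Qed.

Lemma sphere_dot_bound n x y :
  sphere n x -> sphere n y -> -1 <= dot n x y <= 1.
Proof.
  intros [_ Hx] [_ Hy]. pose proof (cauchy_schwarz n x y).
  rewrite Hx, Hy in H. nra.
Qed.

Lemma sphere_dot1_eq n x y :
  sphere n x -> sphere n y -> dot n x y = 1 -> x = y.
Proof.
  intros [Sx Hx] [Sy Hy] H. apply functional_extensionality; intros i.
  assert (E : comb 1 x (-1) y i = 0).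
  { apply (supp_dot0 n); [now apply supp_comb|].
    rewrite !dot_comb_l, !dot_comb_r, (dot_sym n y x), Hx, Hy, H; ring. }
  unfold comb in E; lra.
Qed.

Lemma sphere_opp n x : sphere n x -> sphere n (comb (-1) x 0 x).
Proof.
  intros [Sx Hx]. split; [now apply supp_comb|].
  rewrite !dot_comb_l, !dot_comb_r, Hx; ring.
Qed.

(** Subtracting from x its projection onto the span of the orthonormal pair p, P leaves a vector of
    nonnegative squared norm. *)
Lemma bessel n p P x :
  sphere n p -> sphere n P -> sphere n x -> dot n P p = 0 ->
  dot n p x * dot n p x + dot n P x * dot n P x <= 1.
Proof.
  intros [_ Hp] [_ HP] [_ Hx] H.
  pose proof (dot_pos n
    (comb 1 x (-1) (comb (dot n p x) p (dot n P x) P))) as D.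
  repeat rewrite ?dot_comb_l, ?dot_comb_r in D.
  rewrite (dot_sym n x p),
    (dot_sym n x P), (dot_sym n p P), Hp, HP, Hx, H in D. nra.
Qed.

Definition normal (n : nat) (v : vec) : vec :=
  comb (/ sqrt (dot n v v)) v 0 v.

Lemma sphere_normal n v : supp n v -> 0 < dot n v v -> sphere n (normal n v).
Proof.
  intros Sv Hv. unfold normal. split; [now apply supp_comb|].
  pose proof (sqrt_lt_R0 _ Hv) as Hs. pose proof (sqrt_sqrt (dot n v v) (Rlt_le _ _ Hv)) as E.
  rewrite !dot_comb_l, !dot_comb_r.
  set (r := sqrt (dot n v v)) in *. rewrite <- E. field. lra.
Qed.

Lemma dot_normal n v x :
  0 < dot n v v -> sqrt (dot n v v) * dot n (normal n v) x = dot n v x.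
Proof.
  intros Hv. pose proof (sqrt_lt_R0 _ Hv). unfold normal.
  rewrite dot_comb_l. field. lra.
Qed.

Lemma cone_normal n K v :
  0 < dot n v v -> K (normal n v) -> cone K v.
Proof.
  intros Hv HK. pose proof (sqrt_lt_R0 _ Hv).
  exists (sqrt (dot n v v)), (normal n v). split; [lra|split; [exact HK|]].
  intros i; unfold normal, comb; field; lra.
Qed.

(** A ray from the origin meets the sphere once: v = l u with l > 0 and |u| = 1 forces l = |v|, so u
    is the normalization of v. *)
Lemma cone_inv n K v :
  (forall x, K x -> sphere n x) -> cone K v ->
  0 < dot n v v /\ K (normal n v).
Proof.
  intros KS (l & u & Hl & Hu & E).
  assert (Ev : v = comb l u 0 u).
  { apply functional_extensionality; intros i; rewrite E; unfold comb; ring. }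
  destruct (KS u Hu) as [_ Hu1].
  assert (D : dot n v v = l * l).
  { rewrite Ev, !dot_comb_l, !dot_comb_r, Hu1; ring. }
  split; [rewrite D; nra|].
  replace (normal n v) with u; [exact Hu|].
  apply functional_extensionality; intros i.
  unfold normal, comb. rewrite D, sqrt_square by lra. rewrite E. field. lra.
Qed.

Lemma cone_mem K x : K x -> cone K x.
Proof. intros H; exists 1, x. split; [lra|split; [exact H|intros; ring]]. Qed.

Lemma normal_sphere n x : sphere n x -> normal n x = x.
Proof.
  intros [_ Hx]. apply functional_extensionality; intros i.
  unfold normal, comb; rewrite Hx, sqrt_1; field.
Qed.

Lemma cone_sphere n K x :
  (forall x, K x -> sphere n x) -> sphere n x -> cone K x -> K x.
Proof.
  intros KS Sx Hc. destruct (cone_inv n K x KS Hc) as [_ H].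
  now rewrite normal_sphere in H.
Qed.

(** * Spherical distance in terms of inner products *)

Lemma sdist_lt_of_dot eps :
  0 < eps -> exists delta, 0 < delta /\ forall n P Q,
    sphere n P -> sphere n Q -> 1 - delta < dot n P Q -> sdist n P Q < eps.
Proof.
  (* The cap at 1 keeps [e] below PI, where cosine is decreasing. *)
  intros He. set (e := Rmin eps 1).
  assert (He1 : 0 < e <= 1) by (unfold e; split; [apply Rmin_glb_lt; lra|apply Rmin_r]).
  assert (Hee : e <= eps) by apply Rmin_l.
  pose proof PI2_1.
  assert (Hc : cos e < 1).
  { rewrite <- cos_0. apply cos_decreasing_1; lra. }
  exists (1 - cos e). split; [lra|]. intros n P Q HP HQ H1.
  pose proof (sphere_dot_bound n P Q HP HQ).
  unfold sdist. pose proof (acos_bound (dot n P Q)).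
  apply Rlt_le_trans with e; [|exact Hee].
  apply cos_decreasing_0; try lra. rewrite cos_acos; lra.
Qed.

Lemma dot_of_sdist_lt delta :
  0 < delta -> exists eps, 0 < eps /\ forall n P Q,
    sphere n P -> sphere n Q -> sdist n P Q < eps -> 1 - delta < dot n P Q.
Proof.
  intros Hd. set (d := Rmin delta 1).
  assert (Hd1 : 0 < d <= 1) by (unfold d; split; [apply Rmin_glb_lt; lra|apply Rmin_r]).
  assert (Hdd : d <= delta) by apply Rmin_l.
  exists (acos (1 - d)).
  pose proof (acos_bound (1 - d)) as B.
  assert (C : cos (acos (1 - d)) = 1 - d) by (apply cos_acos; lra).
  split.
  - destruct (Req_dec (acos (1 - d)) 0) as [E|E]; [|lra].
    rewrite E, cos_0 in C; lra.
  - intros n P Q HP HQ H. pose proof (sphere_dot_bound n P Q HP HQ).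
    unfold sdist in H. pose proof (acos_bound (dot n P Q)).
    assert (cos (acos (1 - d)) < cos (acos (dot n P Q)))
      by (apply cos_decreasing_1; lra).
    rewrite C, cos_acos in H2; lra.
Qed.

Lemma cos_strict_bound tau : 0 < tau < PI -> -1 < cos tau < 1.
Proof.
  intros Ht. rewrite <- cos_0, <- cos_PI. split; apply cos_decreasing_1; lra.
Qed.

Lemma sdist_le_iff n P Q tau :
  sphere n P -> sphere n Q -> 0 < tau < PI ->
  (sdist n P Q <= tau <-> cos tau <= dot n P Q).
Proof.
  intros HP HQ Ht. pose proof (sphere_dot_bound n P Q HP HQ).
  unfold sdist. pose proof (acos_bound (dot n P Q)).
  rewrite <- (cos_acos (dot n P Q)) at 2 by lra.
  split; intros H1; [apply cos_decr_1|apply cos_decr_0]; lra.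
Qed.

Lemma sdist_eq_iff n P Q tau :
  sphere n P -> sphere n Q -> 0 < tau < PI ->
  (sdist n P Q = tau <-> dot n P Q = cos tau).
Proof.
  intros HP HQ Ht. pose proof (sphere_dot_bound n P Q HP HQ).
  unfold sdist. split; intros H1.
  - rewrite <- H1, cos_acos; lra.
  - rewrite H1; apply acos_cos; lra.
Qed.

(** * Convex closed sets and the points where segments leave them *)

(* On the sphere closedness is tested with inner products: [x] is a limit of
   points of [K] when their inner products with [x] tend to 1. *)
Definition dot_closed (n : nat) (K : vec -> Prop) : Prop :=
  forall P, sphere n P ->
    (forall delta, 0 < delta -> exists Q, K Q /\ 1 - delta < dot n P Q) -> K P.

(** For K on the sphere, [cone K] does not contain the zero vector, so this form of convexity also
    rules out antipodal pairs. *)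
Definition radially_convex (K : vec -> Prop) : Prop :=
  forall x y a b, K x -> K y -> 0 <= a -> 0 <= b -> 0 < a + b ->
    cone K (comb a x b y).

Record convex_closed (n : nat) (K : vec -> Prop) : Prop := {
  cc_sphere : forall x, K x -> sphere n x;
  cc_closed : dot_closed n K;
  cc_convex : radially_convex K }.

(* AM-GM for [sqrt A * sqrt N] makes the estimate of the angle elementary. *)
Lemma ray_continuous n x d delta :
  0 < dot n x x -> 0 < delta ->
  exists eta, 0 < eta /\ forall t, Rabs t < eta ->
    0 < dot n (comb 1 x t d) (comb 1 x t d) /\
    1 - delta < dot n (normal n x) (normal n (comb 1 x t d)).
Proof.
  intros HA Hd.
  set (A := dot n x x) in *. set (B := Rabs (dot n x d)). set (D := dot n d d).
  assert (HB : 0 <= B) by apply Rabs_pos.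
  assert (HD : 0 <= D) by apply dot_pos.
  set (m := Rmin delta 1).
  assert (Hm : 0 < m <= 1) by (unfold m; split; [apply Rmin_glb_lt; lra|apply Rmin_r]).
  assert (Hmd : m <= delta) by apply Rmin_l.
  (* For |t| < eta both 2 |t x.d| and 2 t^2 D stay below m A, so x + t d keeps positive length and A
     + t x.d > A / 2. *)
  set (eta := Rmin 1 (m * A / (2 * (B + D + 1)))).
  assert (He0 : 0 < m * A / (2 * (B + D + 1))).
  { apply Rdiv_lt_0_compat; nra. }
  assert (He : 0 < eta) by (unfold eta; apply Rmin_glb_lt; lra).
  exists eta. split; [exact He|]. intros t Ht.
  assert (T1 : Rabs t < 1) by (eapply Rlt_le_trans; [exact Ht|apply Rmin_l]).
  assert (T2 : Rabs t * (2 * (B + D + 1)) < m * A).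
  { assert (Rabs t < m * A / (2 * (B + D + 1)))
      by (eapply Rlt_le_trans; [exact Ht|apply Rmin_r]).
    apply (Rmult_lt_compat_r (2 * (B + D + 1))) in H; [|lra].
    replace (m * A / (2 * (B + D + 1)) * (2 * (B + D + 1))) with (m * A) in H
      by (field; lra). exact H. }
  assert (TB : Rabs (t * dot n x d) <= Rabs t * B) by (rewrite Rabs_mult; unfold B; lra).
  pose proof (Rabs_pos t) as Tp.
  pose proof (Rle_abs (- (t * dot n x d))) as TB'. rewrite Rabs_Ropp in TB'.
  assert (Tsq : t * t <= Rabs t).
  { rewrite <- (Rabs_pos_eq (t * t)) by nra. rewrite Rabs_mult. nra. }
  assert (DN : dot n (comb 1 x t d) (comb 1 x t d)
               = A + 2 * (t * dot n x d) + t * t * D).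
  { rewrite !dot_comb_l, !dot_comb_r, (dot_sym n d x). unfold A, D. ring. }
  assert (DX : dot n x (comb 1 x t d) = A + t * dot n x d).
  { rewrite dot_comb_r. unfold A. ring. }
  set (b := t * dot n x d) in *.
  assert (Hb : - b <= Rabs t * B) by lra.
  assert (Hbm : Rabs t * B * 2 < m * A) by nra.
  assert (HDm : t * t * D * 2 < m * A) by nra.
  assert (HmA : m * A <= A) by nra.
  assert (HN : 0 < A + 2 * b + t * t * D) by nra.
  split; [rewrite DN; exact HN|].
  set (v := comb 1 x t d) in *.
  assert (HNv : 0 < dot n v v) by (rewrite DN; exact HN).
  pose proof (dot_normal n x (normal n v) HA) as E1.
  pose proof (dot_normal n v x HNv) as E2.
  fold A in E1. rewrite (dot_sym n v x), DX in E2.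
  rewrite (dot_sym n (normal n v) x) in E2. rewrite DN in E2.
  pose proof (sqrt_lt_R0 _ HA) as SA. pose proof (sqrt_lt_R0 _ HN) as SN.
  pose proof (sqrt_sqrt A ltac:(lra)) as QA.
  pose proof (sqrt_sqrt _ (Rlt_le _ _ HN)) as QN.
  set (a := sqrt A) in *. set (r := sqrt (A + 2 * b + t * t * D)) in *.
  set (z := dot n (normal n x) (normal n v)) in *.
  assert (E3 : r * a * z = A + b) by (rewrite <- E2, <- E1; ring).
  assert (AG : 2 * (r * a) <= 2 * A + 2 * b + t * t * D)
    by (pose proof (Rle_0_sqr (r - a)); unfold Rsqr in *; lra).
  assert (Hra : 0 < r * a) by nra.
  (* The cosine z is (A + b) / (r a), and r a exceeds A + b by at most t^2 D / 2, which is less than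
     m (A + b). *)
  assert (F : (1 - m) * (r * a) < r * a * z).
  { rewrite E3.
    apply Rle_lt_trans with ((1 - m) * (A + b + t * t * D / 2)).
    - apply Rmult_le_compat_l; lra.
    - assert (0 <= t * t * D) by nra.
      assert (m * (A / 2) <= m * (A + b)) by (apply Rmult_le_compat_l; lra).
      assert (0 <= m * (t * t * D)) by nra. lra. }
  assert (1 - m < z); [|lra].
  apply (Rmult_lt_reg_l (r * a)); lra.
Qed.

Lemma cone_ext K v w : (forall i, v i = w i) -> cone K v -> cone K w.
Proof. intros E; replace w with v; [easy|now apply functional_extensionality]. Qed.

(** The exit point sits at the supremum m of the parameters whose point lies in the cone: closedness
    keeps the point at m in K, and points just beyond m are outside. *)
Lemma segment_exit n K a b :
  convex_closed n K -> supp n a -> supp n b ->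
  (forall t, 0 <= t <= 1 -> 0 < dot n (comb (1 - t) a t b) (comb (1 - t) a t b)) ->
  cone K a -> ~ cone K b ->
  exists t, 0 <= t < 1 /\ K (normal n (comb (1 - t) a t b)) /\
    sph_boundary n K (normal n (comb (1 - t) a t b)).
Proof.
  intros [KS KC _] Sa Sb HN Ha Hb.
  set (g := fun t => comb (1 - t) a t b).
  assert (Sg : forall t, 0 <= t <= 1 -> sphere n (normal n (g t))).
  { intros t Ht. apply sphere_normal; [now apply supp_comb|now apply HN]. }
  assert (Eg : forall m t, g t = comb 1 (g m) (t - m) (comb 1 b (-1) a)).
  { intros m t. apply functional_extensionality; intros i. unfold g, comb; ring. }
  destruct (completeness (fun t => 0 <= t <= 1 /\ cone K (g t))) as [m [Hub Hlub]].
  - exists 1. intros t [Ht _]; lra.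
  - exists 0. split; [lra|]. apply cone_ext with a; [|exact Ha].
    intros i; unfold g, comb; ring.
  - assert (H0 : 0 <= m).
    { apply Hub. split; [lra|]. apply cone_ext with a; [|exact Ha].
      intros i; unfold g, comb; ring. }
    assert (H1 : m <= 1) by (apply Hlub; intros t [Ht _]; lra).
    assert (Hm : K (normal n (g m))).
    { apply KC; [apply Sg; lra|]. intros delta Hd.
      destruct (ray_continuous n (g m) (comb 1 b (-1) a) delta) as (eta & He & Hray);
        [apply HN; lra|exact Hd|].
      destruct (classic (exists t, (0 <= t <= 1 /\ cone K (g t)) /\ m - eta < t))
        as [(t & [Ht Hc] & Hmt)|Hno].
      - exists (normal n (g t)). split; [now apply cone_inv|].
        assert (t <= m) by (apply Hub; now split).
        rewrite (Eg m t). apply Hray. rewrite Rabs_left1; lra.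
      - assert (m <= m - eta); [|lra].
        apply Hlub. intros t Ht. apply Rnot_lt_le. intros Hlt. apply Hno.
        now exists t. }
    assert (Hm1 : m < 1).
    { destruct H1 as [H1|H1]; [exact H1|]. exfalso. apply Hb.
      apply cone_ext with (g m); [intros i; unfold g, comb; rewrite H1; ring|].
      apply cone_normal with n; [apply HN; lra|exact Hm]. }
    exists m. split; [lra|]. split; [exact Hm|]. split; [apply Sg; lra|].
    intros eps He. destruct (sdist_lt_of_dot eps He) as (delta & Hd & Hdist).
    assert (Smm := Sg m ltac:(lra)).
    split.
    + exists (normal n (g m)). split; [exact Hm|]. apply Hdist; try assumption.
      destruct Smm as [_ E]. fold (g m). rewrite E; lra.
    + destruct (ray_continuous n (g m) (comb 1 b (-1) a) delta) as (eta & Het & Hray);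
        [apply HN; lra|exact Hd|].
      (* This t is beyond m, still on the segment, and within eta of m. *)
      set (t := m + Rmin (eta / 2) (1 - m)).
      pose proof (Rmin_l (eta / 2) (1 - m)). pose proof (Rmin_r (eta / 2) (1 - m)).
      assert (0 < Rmin (eta / 2) (1 - m)) by (apply Rmin_glb_lt; lra).
      assert (Ht : 0 <= t <= 1) by (unfold t; lra).
      exists (normal n (g t)). split; [now apply Sg|]. split.
      * intros HK. assert (t <= m); [|unfold t in *; lra].
        apply Hub. split; [exact Ht|]. apply cone_normal with n; [now apply HN|exact HK].
      * apply Hdist; [exact Smm|now apply Sg|]. fold (g m).
        rewrite (Eg m t). apply Hray. rewrite Rabs_right; unfold t; lra.
Qed.

Lemma interior_mem n K o : sph_interior_pt n K o -> K o.
Proof.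
  intros [So (eps & He & Hint)]. apply Hint; [exact So|].
  unfold sdist. rewrite (proj2 So), acos_1. exact He.
Qed.

Lemma interior_ray n K o d :
  (forall x, K x -> sphere n x) -> sph_interior_pt n K o -> supp n d ->
  exists eta, 0 < eta /\ forall t, Rabs t < eta -> cone K (comb 1 o t d).
Proof.
  intros KS [So (eps & He & Hint)] Sd.
  destruct (sdist_lt_of_dot eps He) as (delta & Hd & Hdist).
  assert (Ho : 0 < dot n o o) by (destruct So as [_ E]; rewrite E; lra).
  destruct (ray_continuous n o d delta Ho Hd) as (eta & Het & Hray).
  exists eta. split; [exact Het|]. intros t Ht. destruct (Hray t Ht) as [HN HD].
  assert (Sv : sphere n (normal n (comb 1 o t d)))
    by (apply sphere_normal; [apply supp_comb; [exact (proj1 So)|exact Sd]|exact HN]).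
  apply cone_normal with n; [exact HN|].
  rewrite (normal_sphere n o So) in HD.
  apply Hint; [exact Sv|]. now apply Hdist.
Qed.

(** Minimality gives c |p + t k| <= y.(p + t k) for every t > 0; the claim is its derivative at t =
    0, obtained below from a single explicit t instead of a limit. *)
Lemma first_order n K y p k c :
  convex_closed n K -> K p -> K k ->
  (forall u, K u -> c <= dot n y u) -> dot n y p = c ->
  c * dot n p k <= dot n y k.
Proof.
  intros [KS KC KR] Hp Hk Hmin Hyp.
  set (h := dot n p k). set (e := dot n y k).
  assert (Hh : -1 <= h <= 1) by (apply sphere_dot_bound; now apply KS).
  assert (Main : forall t, 0 < t ->
    exists l, 0 <= l /\ l * l = 1 + 2 * t * h + t * t /\ c * l <= c + t * e).
  { intros t Ht. destruct (cone_inv n K (comb 1 p t k) KS) as [HN HK].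
    { apply KR; try assumption; lra. }
    exists (sqrt (dot n (comb 1 p t k) (comb 1 p t k))).
    split; [apply sqrt_pos|]. split.
    - rewrite sqrt_sqrt by lra. rewrite !dot_comb_l, !dot_comb_r, (dot_sym n k p).
      fold h. destruct (KS p Hp) as [_ ->]. destruct (KS k Hk) as [_ ->]. ring.
    - pose proof (dot_normal n _ y HN) as E. rewrite (dot_sym n (comb 1 p t k) y) in E.
      rewrite (dot_comb_r n 1 p t k y), Hyp in E. fold e in E.
      apply Rle_trans with (1 * c + t * e); [|lra]. rewrite <- E, Rmult_comm.
      apply Rmult_le_compat_l; [apply sqrt_pos|]. rewrite dot_sym. now apply Hmin. }
  apply Rnot_lt_le. intros Hlt.
  destruct (Rle_or_lt 0 c) as [Hc|Hc].
  (* For c >= 0 the value t = 1 suffices, since |p + k| >= (p + k).p = 1 + h. *)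
  - destruct (Main 1 ltac:(lra)) as (l & Hl & El & Hle).
    assert (1 + h <= l) by nra.
    assert (c * (1 + h) <= c * l) by (apply Rmult_le_compat_l; lra). lra.
  (* For c < 0 this t satisfies e = c h + c t. With l <= (1 + l^2) / 2 the inequality becomes c t^2
     / 2 <= c t^2, which is false. *)
  - destruct (Main ((c * h - e) / (- c))) as (l & Hl & El & Hle).
    { apply Rdiv_lt_0_compat; lra. }
    set (t := (c * h - e) / (- c)) in *.
    assert (Ht : 0 < t) by (unfold t; apply Rdiv_lt_0_compat; lra).
    assert (Et : e = c * h + c * t) by (unfold t; field; lra).
    assert (Hl2 : l <= 1 + t * h + t * t / 2)
      by (pose proof (Rle_0_sqr (l - 1)); unfold Rsqr in *; lra).
    assert (c * (1 + t * h + t * t / 2) <= c * l)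
      by (apply Rmult_le_compat_neg_l; lra).
    rewrite Et in Hle. assert (0 < - c * (t * t)) by (apply Rmult_lt_0_compat; nra). lra.
Qed.

(** * Compactness: linear functions attain their maximum *)

(* Compactness, one coordinate at a time: [l] is the limit superior of the
   [j]-th coordinate along the nested family [A]. *)
Lemma nested_cluster_coord (A : R -> vec -> Prop) (j : nat) :
  (forall e, 0 < e -> exists u, A e u) ->
  (forall e e' u, 0 < e <= e' -> A e u -> A e' u) ->
  (forall e u, 0 < e -> A e u -> -1 <= u j <= 1) ->
  exists l, forall e, 0 < e -> exists u, A e u /\ l - e < u j < l + e.
Proof.
  intros HA Hmon Hb.
  destruct (completeness (fun x => forall e, 0 < e -> exists u, A e u /\ x <= u j))
    as [l [Hub Hlub]].
  - exists 1. intros x Hx. destruct (Hx 1 ltac:(lra)) as (u & Hu & Hxu).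
    specialize (Hb 1 u ltac:(lra) Hu). lra.
  - exists (-1). intros e He. destruct (HA e He) as [u Hu]. exists u.
    split; [exact Hu|]. now apply (Hb e).
  - exists l. intros e He.
    assert (H1 : exists e0, 0 < e0 /\ forall u, A e0 u -> u j < l + e).
    { apply NNPP. intros Hno. assert (l + e <= l); [|lra].
      apply Hub. intros e0 He0. apply NNPP. intros Hno'. apply Hno. exists e0.
      split; [exact He0|]. intros u Hu. apply Rnot_le_lt. intros Hle.
      apply Hno'. now exists u. }
    destruct H1 as (e0 & He0 & Hup).
    assert (H2 : exists x, (forall e, 0 < e -> exists u, A e u /\ x <= u j) /\ l - e < x).
    { apply NNPP. intros Hno. assert (l <= l - e); [|lra].
      apply Hlub. intros x Hx. apply Rnot_lt_le. intros Hlt. apply Hno. now exists x. }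
    destruct H2 as (x & Hx & Hlx).
    assert (Hm : 0 < Rmin e e0) by (apply Rmin_glb_lt; lra).
    destruct (Hx _ Hm) as (u & Hu & Hxu). exists u. split; [|split].
    + apply (Hmon (Rmin e e0)); [split; [exact Hm|apply Rmin_l]|exact Hu].
    + lra.
    + apply Hup. apply (Hmon (Rmin e e0)); [split; [exact Hm|apply Rmin_r]|exact Hu].
Qed.

(** Confining coordinate N to the window of size e around its limit yields another nested nonempty
    family, to which the induction hypothesis applies; no subsequences are needed. *)
Lemma nested_cluster (N : nat) (A : R -> vec -> Prop) :
  (forall e, 0 < e -> exists u, A e u) ->
  (forall e e' u, 0 < e <= e' -> A e u -> A e' u) ->
  (forall e u j, 0 < e -> A e u -> -1 <= u j <= 1) ->
  exists l : vec, forall e, 0 < e ->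
    exists u, A e u /\ forall j, (j < N)%nat -> l j - e < u j < l j + e.
Proof.
  revert A. induction N as [|N IH]; intros A HA Hmon Hb.
  - exists (fun _ => 0). intros e He. destruct (HA e He) as [u Hu].
    exists u. split; [exact Hu|intros j Hj; lia].
  - destruct (nested_cluster_coord A N HA Hmon) as [x Hx]; [intros e u; apply Hb|].
    destruct (IH (fun e u => A e u /\ x - e < u N < x + e)) as [l Hl].
    + exact Hx.
    + intros e e' u He [Hu Hxu]. split; [now apply (Hmon e)|lra].
    + intros e u j He [Hu _]. now apply (Hb e).
    + exists (fun j => if Nat.eq_dec j N then x else l j). intros e He.
      destruct (Hl e He) as (u & [Hu Hxu] & Hlu). exists u. split; [exact Hu|].
      intros j Hj. destruct (Nat.eq_dec j N) as [->|Hne]; [exact Hxu|apply Hlu; lia].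
Qed.

Lemma dot_le_of_coords n d e :
  0 <= e -> (forall j, (j <= n)%nat -> - e <= d j <= e) ->
  dot n d d <= INR (S n) * (e * e).
Proof.
  intros He. induction n as [|n IH]; intros H.
  - unfold dot; simpl. specialize (H 0%nat (le_n _)). nra.
  - unfold dot in *. rewrite tech5, S_INR.
    assert (H1 := IH ltac:(intros j Hj; apply H; lia)).
    assert (H2 := H (S n) (le_n _)). nra.
Qed.

(** The points of K within e of the supremum M form a nested family. Its cluster point is a limit of
    them in norm, hence lies on the sphere, belongs to K by closedness and attains M. *)
Lemma linear_max n K y :
  (forall x, K x -> sphere n x) -> dot_closed n K -> (exists k, K k) -> sphere n y ->
  exists u, K u /\ forall k, K k -> dot n y k <= dot n y u.
Proof.
  intros KS KC [k0 Hk0] Sy.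
  destruct (completeness (fun r => exists k, K k /\ r = dot n y k)) as [M [Hub Hlub]].
  - exists 1. intros r (k & Hk & ->). apply sphere_dot_bound; [exact Sy|now apply KS].
  - now exists (dot n y k0), k0.
  - destruct (nested_cluster (S n) (fun e u => K u /\ M - e < dot n y u)) as [l0 Hl0].
    + intros e He. apply NNPP. intros Hno. assert (M <= M - e); [|lra].
      apply Hlub. intros r (k & Hk & ->). apply Rnot_lt_le. intros Hlt. apply Hno.
      now exists k.
    + intros e e' u He [Hu HM]. split; [exact Hu|lra].
    + intros e u j He [Hu _]. destruct (KS u Hu) as [Su Hu1].
      destruct (Compare_dec.le_lt_dec j n) as [Hj|Hj]; [|rewrite (Su j Hj); lra].
      pose proof (coord_sq_le n u j Hj). nra.
    (* The cluster point is controlled only in coordinates 0..n; the others are set to 0, as the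
       sphere requires. *)
    + set (l := fun j => if Compare_dec.le_lt_dec j n then l0 j else 0).
      assert (Sl : supp n l).
      { intros j Hj. unfold l. destruct (Compare_dec.le_lt_dec j n); [lia|reflexivity]. }
      assert (Hl : forall e, 0 < e -> exists u, K u /\ M - e < dot n y u /\
                 dot n (comb 1 l (-1) u) (comb 1 l (-1) u) < e).
      { intros e He. pose proof (lt_0_INR (S n) ltac:(lia)) as HNn.
        set (e1 := Rmin 1 (e / (2 * INR (S n)))).
        assert (P1 : 0 < e / (2 * INR (S n))) by (apply Rdiv_lt_0_compat; lra).
        assert (He1 : 0 < e1) by (apply Rmin_glb_lt; lra).
        assert (He1' : e1 <= 1) by apply Rmin_l.
        assert (He2 : INR (S n) * (e1 * e1) < e).
        { assert (e1 <= e / (2 * INR (S n))) by apply Rmin_r.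
          assert (INR (S n) * e1 <= e / 2).
          { apply (Rmult_le_compat_l (INR (S n))) in H; [|lra].
            replace (INR (S n) * (e / (2 * INR (S n)))) with (e / 2) in H
              by (field; lra). exact H. }
          nra. }
        destruct (Hl0 (Rmin e e1)) as (u & [Hu HM] & Hc); [apply Rmin_glb_lt; lra|].
        pose proof (Rmin_l e e1). pose proof (Rmin_r e e1).
        exists u. split; [exact Hu|]. split; [lra|].
        apply Rle_lt_trans with (INR (S n) * (e1 * e1)); [|exact He2].
        apply dot_le_of_coords; [lra|]. intros j Hj.
        specialize (Hc j ltac:(lia)). unfold comb, l.
        destruct (Compare_dec.le_lt_dec j n); [lra|lia]. }
      (* With |l - u| <= e, Cauchy-Schwarz gives |l.u - 1| <= e, and |l|^2 - 1 = |l - u|^2 + 2 (l.u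
         - 1). *)
      assert (Hnear : forall u e, K u -> 0 <= e <= 1 ->
        dot n (comb 1 l (-1) u) (comb 1 l (-1) u) <= e * e ->
        - 4 * e <= dot n l l - 1 <= 4 * e).
      { intros u e Hu He HD. destruct (KS u Hu) as [_ Hu1].
        pose proof (cauchy_schwarz n (comb 1 l (-1) u) u) as CS.
        set (D := dot n (comb 1 l (-1) u) (comb 1 l (-1) u)) in *.
        assert (ED : D = dot n l l - 2 * dot n l u + 1).
        { unfold D. rewrite !dot_comb_l, !dot_comb_r, (dot_sym n u l), Hu1. ring. }
        rewrite dot_comb_l, Hu1 in CS.
        assert (0 <= D) by apply dot_pos.
        assert (- e <= dot n l u - 1 <= e) by nra.
        nra. }
      assert (Hl1 : dot n l l = 1).
      { apply Rle_antisym; apply Rnot_lt_le; intros Hlt.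
        - set (e := Rmin 1 ((dot n l l - 1) / 8)).
          assert (0 < e) by (apply Rmin_glb_lt; lra).
          assert (e <= 1) by apply Rmin_l.
          assert (e <= (dot n l l - 1) / 8) by apply Rmin_r.
          destruct (Hl (e * e)) as (u & Hu & _ & HD); [nra|].
          specialize (Hnear u e Hu). lra.
        - set (e := Rmin 1 ((1 - dot n l l) / 8)).
          assert (0 < e) by (apply Rmin_glb_lt; lra).
          assert (e <= 1) by apply Rmin_l.
          assert (e <= (1 - dot n l l) / 8) by apply Rmin_r.
          destruct (Hl (e * e)) as (u & Hu & _ & HD); [nra|].
          specialize (Hnear u e Hu). lra. }
      assert (Ssl : sphere n l) by now split.
      exists l. split.
      * apply KC; [exact Ssl|]. intros delta Hd.
        destruct (Hl delta Hd) as (u & Hu & _ & HD). exists u. split; [exact Hu|].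
        destruct (KS u Hu) as [_ Hu1].
        rewrite !dot_comb_l, !dot_comb_r, (dot_sym n u l), Hu1, Hl1 in HD. lra.
      * intros k Hk. assert (dot n y k <= M) by (apply Hub; now exists k).
        assert (M <= dot n y l); [|lra].
        apply Rnot_lt_le. intros Hlt.
        set (e := Rmin 1 ((M - dot n y l) / 4)).
        assert (0 < e) by (apply Rmin_glb_lt; lra).
        assert (e <= 1) by apply Rmin_l.
        assert (e <= (M - dot n y l) / 4) by apply Rmin_r.
        destruct (Hl (e * e)) as (u & Hu & HM & HD); [nra|].
        pose proof (cauchy_schwarz n (comb 1 l (-1) u) y) as CS.
        destruct Sy as [_ Hy]. rewrite Hy in CS.
        rewrite (dot_comb_l n 1 l (-1) u y), (dot_sym n l y), (dot_sym n u y) in CS.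
        set (D := dot n (comb 1 l (-1) u) (comb 1 l (-1) u)) in *.
        (* The gap M - y.l is at least 4 e and y.u > M - e, whereas |l - u| < e allows y.u - y.l at
           most e. *)
        assert (3 * e < dot n y u - dot n y l) by nra. nra.
Qed.

(** * Normals at closest points and touching at boundary points *)

(* At the point [p] of [K] closest to [-y], the tangential part of [y] is normal
   to [K]. *)
Lemma min_normal n K y :
  convex_closed n K -> sphere n y -> (forall k, K k -> -1 < dot n y k) ->
  (exists k, K k /\ dot n y k < 1) ->
  exists p P, K p /\ polar n K P /\ dot n P p = 0 /\
    (forall k, K k -> dot n y p <= dot n y k) /\
    exists r, 0 < r /\ r * r = 1 - dot n y p * dot n y p /\
      P = comb (/ r) y (- dot n y p / r) p.
Proof.
  intros CK Sy Hgt (k1 & Hk1 & Hlt).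
  destruct (linear_max n K (comb (-1) y 0 y)) as (p & Hp & Hmax);
    [apply CK|apply CK|now exists k1|now apply sphere_opp|].
  assert (Hmin : forall k, K k -> dot n y p <= dot n y k).
  { intros k Hk. specialize (Hmax k Hk). rewrite !dot_comb_l in Hmax. lra. }
  set (d := dot n y p) in *.
  (* Strictness on both sides makes the tangential part y - d p nonzero; its length is r. *)
  assert (Hd : -1 < d < 1).
  { split; [now apply Hgt|]. specialize (Hmin k1 Hk1). lra. }
  assert (Hr0 : 0 < 1 - d * d) by nra.
  set (r := sqrt (1 - d * d)).
  assert (Hr : 0 < r) by now apply sqrt_lt_R0.
  assert (Hrr : r * r = 1 - d * d) by (apply sqrt_sqrt; lra).
  destruct (cc_sphere n K CK p Hp) as [Sp Hp1]. destruct Sy as [Sy Hy1].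
  exists p, (comb (/ r) y (- d / r) p). split; [exact Hp|].
  split; [|split; [|split; [exact Hmin|now exists r]]].
  - split; [split; [now apply supp_comb|]|].
    + rewrite !dot_comb_l, !dot_comb_r, (dot_sym n p y). fold d. rewrite Hp1, Hy1.
      transitivity ((1 - d * d) / (r * r)); [field; lra|].
      rewrite Hrr; field; lra.
    + intros k Hk. rewrite dot_comb_l.
      pose proof (first_order n K y p k d CK Hp Hk Hmin eq_refl).
      replace (/ r * dot n y k + - d / r * dot n p k)
        with ((dot n y k - d * dot n p k) / r) by (field; lra).
      apply Rle_mult_inv_pos; lra.
  - rewrite dot_comb_l. fold d. rewrite Hp1. field. lra.
Qed.

(** If x.b had a positive minimum m on B, a point z outside A close to x would still have positive
    inner product with all of B. The lemma serves both K with its polar and the polar with K. *)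
Lemma boundary_touch n (A B : vec -> Prop) x :
  (forall b, B b -> sphere n b) -> dot_closed n B -> (exists b, B b) ->
  sph_boundary n A x -> (forall b, B b -> 0 <= dot n x b) ->
  (forall z, sphere n z -> ~ A z -> exists b, B b /\ dot n z b < 0) ->
  exists b, B b /\ dot n x b = 0.
Proof.
  intros BS BC HB [Sx Hx] Hpos Hneg.
  destruct (linear_max n B (comb (-1) x 0 x) BS BC HB (sphere_opp n x Sx))
    as (b & Hb & Hmax).
  exists b. split; [exact Hb|]. apply Rle_antisym; [|now apply Hpos].
  apply Rnot_lt_le. intros Hm. set (m := dot n x b) in *.
  (* On the sphere x.z > 1 - m^2 / 2 means |x - z| < m. *)
  destruct (dot_of_sdist_lt (m * m / 2)) as (eps & He & Hdist); [nra|].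
  destruct (Hx eps He) as [_ (z & Sz & Hz & Hd)].
  destruct (Hneg z Sz Hz) as (b' & Hb' & Hzb).
  specialize (Hdist n x z Sx Sz Hd). specialize (Hmax b' Hb').
  rewrite !dot_comb_l in Hmax. fold m in Hmax.
  pose proof (cauchy_schwarz n (comb 1 x (-1) z) b') as CS.
  destruct (BS b' Hb') as [_ Hb1]. destruct Sx as [_ Hx1]. destruct Sz as [_ Hz1].
  rewrite !dot_comb_l, !dot_comb_r, (dot_sym n z x), Hb1, Hx1, Hz1 in CS. nra.
Qed.

(** * Bodies of constant diameter and their polars *)

(** Constant diameter arccos c in inner products. [eb_center] stands in for an interior point, so
    that the record applies to the polar body without first giving it an interior. *)
Record extremal_body (n : nat) (K : vec -> Prop) (c : R) : Prop := {
  eb_cc : convex_closed n K;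
  eb_dot : forall x y, K x -> K y -> c <= dot n x y;
  eb_far : forall b, sph_boundary n K b -> exists y, K y /\ dot n b y = c;
  eb_center : exists o, K o /\ forall k, K k -> c < dot n o k }.

(* A segment starting in [K] can leave [K] only through a boundary point, and
   every boundary point has some [k] in [K] at inner product exactly [c]. *)
Lemma segment_stays n K c a b :
  extremal_body n K c -> K a -> sphere n b ->
  (forall t, 0 <= t <= 1 -> 0 < dot n (comb (1 - t) a t b) (comb (1 - t) a t b)) ->
  (forall t k, 0 <= t < 1 -> K k ->
     c * sqrt (dot n (comb (1 - t) a t b) (comb (1 - t) a t b))
     < dot n (comb (1 - t) a t b) k) ->
  K b.
Proof.
  intros [CK _ Hfar _] Ha Sb HN Hin.
  pose proof (cc_sphere n K CK) as KS.
  apply (cone_sphere n K b KS Sb). apply NNPP. intros Hb.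
  destruct (segment_exit n K a b CK (proj1 (KS a Ha)) (proj1 Sb) HN (cone_mem K a Ha) Hb)
    as (t & Ht & _ & Hbd).
  destruct (Hfar _ Hbd) as (y & Hy & E).
  specialize (Hin t y Ht Hy).
  rewrite <- (dot_normal n _ y) in Hin by (apply HN; lra). rewrite E in Hin. lra.
Qed.

Lemma dot_segment n a b t :
  sphere n a -> sphere n b ->
  dot n (comb (1 - t) a t b) (comb (1 - t) a t b)
  = (1 - t) * (1 - t) + t * t + 2 * t * (1 - t) * dot n a b.
Proof.
  intros [_ Ha] [_ Hb]. rewrite !dot_comb_l, !dot_comb_r, (dot_sym n b a), Ha, Hb. ring.
Qed.

(** Here h is the inner product of the unit end points. The upper bound 1 serves the case c >= 0,
    the lower bound by 1 - t the case c < 0. *)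
Lemma segment_sq_bounds t h :
  0 <= t <= 1 -> 0 <= h <= 1 ->
  0 < (1 - t) * (1 - t) + t * t + 2 * t * (1 - t) * h <= 1 /\
  (1 - t) * (1 - t) <= (1 - t) * (1 - t) + t * t + 2 * t * (1 - t) * h /\
  t * t <= (1 - t) * (1 - t) + t * t + 2 * t * (1 - t) * h.
Proof.
  intros Ht Hh. assert (H : 0 <= t * (1 - t)) by nra.
  assert (0 <= t * (1 - t) * h) by nra.
  assert (0 <= t * (1 - t) * (1 - h)) by nra.
  repeat split; nra.
Qed.

Lemma scale_le_sqrt l x : 0 <= l -> l * l <= x -> l <= sqrt x.
Proof. intros Hl H. rewrite <- (sqrt_square l Hl). now apply sqrt_le_1_alt. Qed.

(** On the segment from the centre o to x the inner product with k exceeds c before the end, and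
    normalizing cannot spoil this: the norm is at most 1 and c >= 0. *)
Lemma ball_hull n K c x :
  0 <= c -> extremal_body n K c -> sphere n x ->
  (forall k, K k -> c <= dot n x k) -> K x.
Proof.
  intros Hc EK Sx Hx. destruct (eb_center n K c EK) as (o & Ho & Hok).
  pose proof (cc_sphere n K (eb_cc n K c EK)) as KS.
  pose proof (Hx o Ho) as Hxo. rewrite dot_sym in Hxo.
  pose proof (sphere_dot_bound n o x (KS o Ho) Sx).
  apply (segment_stays n K c o x EK Ho Sx).
  - intros t Ht. rewrite (dot_segment n o x t (KS o Ho) Sx).
    apply segment_sq_bounds; lra.
  - intros t k Ht Hk. rewrite (dot_segment n o x t (KS o Ho) Sx), dot_comb_l.
    specialize (Hok k Hk). specialize (Hx k Hk).
    assert (sqrt ((1 - t) * (1 - t) + t * t + 2 * t * (1 - t) * dot n o x) <= 1).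
    { apply Rle_trans with (sqrt 1); [|rewrite sqrt_1; lra].
      apply sqrt_le_1_alt, segment_sq_bounds; lra. }
    assert (c * sqrt ((1 - t) * (1 - t) + t * t + 2 * t * (1 - t) * dot n o x) <= c) by nra.
    assert (0 < (1 - t) * (dot n o k - c)) by (apply Rmult_lt_0_compat; lra).
    assert (0 <= t * (dot n x k - c)) by (apply Rmult_le_pos; lra). lra.
Qed.

(** As c < 0, lower bounds on the norm suffice: it is at least 1 - t on the segment from o to P, and
    greater than t before the end of the segment from P to x. *)
Lemma polar_ball n K c P x :
  c < 0 -> extremal_body n K c -> polar n K P -> sphere n x ->
  0 <= dot n P x -> 1 - c * c <= dot n P x * dot n P x -> K x.
Proof.
  intros Hc EK [SP HP] Sx Hpx Hx.
  destruct (eb_center n K c EK) as (o & Ho & Hok).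
  pose proof (cc_sphere n K (eb_cc n K c EK)) as KS.
  assert (KP : K P).
  { pose proof (HP o Ho) as HPo. rewrite dot_sym in HPo.
    apply (segment_stays n K c o P EK Ho SP).
    - intros t Ht. rewrite (dot_segment n o P t (KS o Ho) SP).
      pose proof (sphere_dot_bound n o P (KS o Ho) SP).
      apply segment_sq_bounds; lra.
    - intros t k Ht Hk. rewrite (dot_segment n o P t (KS o Ho) SP), dot_comb_l.
      specialize (Hok k Hk). specialize (HP k Hk).
      assert (1 - t <= sqrt ((1 - t) * (1 - t) + t * t + 2 * t * (1 - t) * dot n o P))
        by (pose proof (sphere_dot_bound n o P (KS o Ho) SP);
            apply scale_le_sqrt; [lra|apply segment_sq_bounds; lra]).
      assert (0 < (1 - t) * (dot n o k - c)) by (apply Rmult_lt_0_compat; lra).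
      assert (0 <= t * dot n P k) by (apply Rmult_le_pos; lra).
      set (r := sqrt _) in *.
      assert (0 <= - c * (r - (1 - t))) by (apply Rmult_le_pos; lra). lra. }
  pose proof (sphere_dot_bound n P x SP Sx).
  set (h := dot n P x) in *.
  apply (segment_stays n K c P x EK KP Sx).
  - intros t Ht. rewrite (dot_segment n P x t SP Sx). fold h.
    apply segment_sq_bounds; lra.
  - intros t k Ht Hk. rewrite (dot_segment n P x t SP Sx), dot_comb_l. fold h.
    specialize (HP k Hk).
    (* the angle between [x] and [k] is at most the sum of their angles with [P] *)
    assert (Hxk : c + h * dot n P k <= dot n x k).
    { pose proof (cauchy_schwarz n (comb 1 x (- h) P) k) as CS.
      destruct SP as [_ HP1]. destruct Sx as [_ Hx1]. destruct (KS k Hk) as [_ Hk1].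
      rewrite !dot_comb_l, !dot_comb_r, (dot_sym n x P), HP1, Hx1, Hk1 in CS.
      fold h in CS. set (z := dot n x k - h * dot n P k).
      assert (z * z <= c * c) by (unfold z; lra).
      assert (c <= z) by nra. unfold z in *. lra. }
    set (N := (1 - t) * (1 - t) + t * t + 2 * t * (1 - t) * h).
    assert (HtN : t < sqrt N).
    { rewrite <- (sqrt_square t) at 1 by lra. apply sqrt_lt_1_alt.
      unfold N. assert (0 < (1 - t) * (1 - t)) by nra.
      assert (0 <= t * (1 - t) * h) by (apply Rmult_le_pos; nra).
      split; [nra|lra]. }
    assert (0 <= h * dot n P k) by nra.
    assert (0 <= (1 - t) * dot n P k) by nra.
    assert (t * c <= t * dot n x k) by (apply Rmult_le_compat_l; lra).
    assert (0 < - c * (sqrt N - t)) by (apply Rmult_lt_0_compat; lra). lra.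
Qed.

(** The point is the end of the arc of length arccos c that starts at p in the direction of P, the
    inner normal at p. *)
Lemma opposite_point n K c s p P :
  0 < s -> s * s = 1 - c * c -> extremal_body n K c ->
  K p -> polar n K P -> dot n P p = 0 -> K (comb c p s P).
Proof.
  intros Hs Hsc EK Hp [SP HP] HPp.
  pose proof (cc_sphere n K (eb_cc n K c EK)) as KS.
  pose proof (KS p Hp) as Sp.
  assert (Sy : sphere n (comb c p s P)).
  { split; [apply supp_comb; [exact (proj1 Sp)|exact (proj1 SP)]|].
    destruct Sp as [_ Hp1]. destruct SP as [_ HP1].
    rewrite !dot_comb_l, !dot_comb_r, (dot_sym n p P), Hp1, HP1, HPp. lra. }
  assert (HPy : dot n P (comb c p s P) = s).
  { rewrite dot_comb_r, HPp, (proj2 SP). ring. }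
  destruct (Rlt_or_le c 0) as [Hc|Hc].
  { apply (polar_ball n K c P); try assumption; [now split|lra|].
    rewrite HPy. lra. }
  apply (ball_hull n K c _ Hc EK Sy). intros k Hk.
  apply Rnot_lt_le. intros Hlt. rewrite dot_comb_l in Hlt.
  pose proof (HP k Hk) as He.
  pose proof (sphere_dot_bound n p k Sp (KS k Hk)) as Hh.
  pose proof (eb_dot n K c EK p k Hp Hk) as Hch.
  set (h := dot n p k) in *. set (e := dot n P k) in *.
  (* [p + eps T] lies outside the hemisphere of [P], yet every ball of the ball
     hull containing [p] and [k] contains it when [eps] is small *)
  set (mu := (e + c * (1 - h) / s) / 2).
  assert (Hmu : e < mu /\ s * mu < c * (1 - h)).
  { assert (e < c * (1 - h) / s).
    { apply (Rmult_lt_reg_l s); [exact Hs|].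
      replace (s * (c * (1 - h) / s)) with (c * (1 - h)) by (field; lra). lra. }
    split; [unfold mu; lra|].
    replace (c * (1 - h)) with (s * (c * (1 - h) / s)) by (field; lra).
    apply Rmult_lt_compat_l; [exact Hs|unfold mu; lra]. }
  destruct Hmu as [Hmu1 Hmu2].
  (* Removing h p makes T tangent at p, and mu > e makes T.P negative. *)
  set (T := comb 1 k (-1) (comb h p mu P)).
  assert (ST : supp n T).
  { apply supp_comb; [exact (proj1 (KS k Hk))|apply supp_comb; [exact (proj1 Sp)|exact (proj1 SP)]]. }
  destruct Sp as [Sp Hp1]. destruct SP as [SP HP1].
  assert (HTp : dot n T p = 0).
  { unfold T. rewrite !dot_comb_l, HPp, Hp1, (dot_sym n k p). fold h. ring. }
  assert (HTP : dot n T P = e - mu).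
  { unfold T. rewrite !dot_comb_l, HP1, (dot_sym n k P), (dot_sym n p P), HPp.
    fold e. ring. }
  pose proof (dot_pos n T) as HT. set (D := dot n T T) in *.
  set (eta := c * (1 - h) - mu * s).
  assert (Heta : 0 < eta) by (unfold eta; lra).
  (* For u in K, w.u >= c + ep eta, while c |w| <= c + ep^2 c D / 2; this size of [ep] makes the
     first larger. *)
  set (ep := Rmin 1 (eta / (c * D + 1))).
  assert (HcD : 0 <= c * D) by nra.
  assert (Hep : 0 < ep).
  { apply Rmin_glb_lt; [lra|]. apply Rdiv_lt_0_compat; lra. }
  assert (Hep1 : ep <= 1) by apply Rmin_l.
  assert (Hep2 : ep * (c * D) < 2 * eta).
  { assert (H1 : ep <= eta / (c * D + 1)) by apply Rmin_r.
    apply (Rmult_le_compat_r (c * D + 1)) in H1; [|lra].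
    replace (eta / (c * D + 1) * (c * D + 1)) with eta in H1 by (field; lra). nra. }
  set (w := comb 1 p ep T).
  assert (Hww : dot n w w = 1 + ep * ep * D).
  { unfold w. rewrite !dot_comb_l, !dot_comb_r, (dot_sym n p T), HTp, Hp1.
    unfold D. ring. }
  assert (Hw0 : 0 < dot n w w) by (rewrite Hww; nra).
  assert (Sw : sphere n (normal n w)).
  { apply sphere_normal; [now apply supp_comb|exact Hw0]. }
  pose proof (sqrt_lt_R0 _ Hw0) as Hsq.
  assert (Hout : ~ K (normal n w)).
  { intros HK. specialize (HP _ HK). rewrite dot_sym in HP.
    assert (0 <= dot n w P) by (rewrite <- dot_normal by exact Hw0; nra).
    unfold w in H. rewrite dot_comb_l, HTP, (dot_sym n p P), HPp in H. nra. }
  apply Hout. apply (ball_hull n K c _ Hc EK Sw). intros u Hu.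
  apply Rnot_lt_le. intros Hwu.
  apply (Rmult_lt_compat_l (sqrt (dot n w w))) in Hwu; [|exact Hsq].
  rewrite dot_normal in Hwu by exact Hw0.
  assert (Hsq2 : sqrt (dot n w w) <= 1 + ep * ep * D / 2).
  { pose proof (sqrt_sqrt _ (Rlt_le _ _ Hw0)) as Q.
    pose proof (Rle_0_sqr (sqrt (dot n w w) - 1)) as Q1. unfold Rsqr in Q1.
    rewrite Hww in *. lra. }
  assert (Hcw : sqrt (dot n w w) * c <= (1 + ep * ep * D / 2) * c)
    by (apply Rmult_le_compat_r; lra).
  unfold w in Hwu at 1. rewrite dot_comb_l in Hwu.
  unfold T in Hwu. rewrite !dot_comb_l in Hwu.
  pose proof (eb_dot n K c EK p u Hp Hu) as Hpu.
  pose proof (eb_dot n K c EK k u Hk Hu) as Hku.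
  pose proof (bessel n p P u (conj Sp Hp1) (conj SP HP1) (KS u Hu) HPp) as HB.
  pose proof (HP u Hu) as HPu.
  pose proof (sphere_dot_bound n p u (conj Sp Hp1) (KS u Hu)) as Hpu1.
  set (a := dot n p u) in *. set (q := dot n P u) in *.
  (* By Bessel q^2 <= 1 - a^2, and a >= c >= 0. *)
  assert (Hq : q <= s) by nra.
  assert (F1 : mu * q <= mu * s) by nra.
  assert (F2 : c * (1 - ep * h) <= a * (1 - ep * h)).
  { apply Rmult_le_compat_r; [|lra]. nra. }
  assert (F3 : ep * (c - mu * s) <= ep * (dot n k u - mu * q))
    by (apply Rmult_le_compat_l; lra).
  assert (F4 : ep * (ep * (c * D)) < ep * (2 * eta)) by (apply Rmult_lt_compat_l; lra).
  unfold eta in F4. fold w in Hcw. lra.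
Qed.

(** For c = cos tau the conclusion is the form that [width_eq_polar] gives to width tau at P. *)
Lemma extremal_body_polar n K c p P :
  -1 < c < 1 -> extremal_body n K c -> K p -> polar n K P -> dot n P p = 0 ->
  (exists Q, polar n K Q /\ dot n P Q = - c) /\
  (forall Q, polar n K Q -> - c <= dot n P Q).
Proof.
  intros Hc1 EK Hp HP HPp.
  set (s := sqrt (1 - c * c)).
  assert (Hs : 0 < s) by (apply sqrt_lt_R0; nra).
  assert (Hsc : s * s = 1 - c * c) by (apply sqrt_sqrt; nra).
  pose proof (opposite_point n K c s p P Hs Hsc EK Hp HP HPp) as Hy.
  pose proof (cc_sphere n K (eb_cc n K c EK)) as KS.
  pose proof (KS p Hp) as [Sp Hp1]. pose proof HP as [[SP HP1] HPpos].
  assert (HPp' : dot n p P = 0) by now rewrite dot_sym.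
  split.
  - exists (comb (/ s) p (- c / s) (comb c p s P)). split; [split; [split|]|].
    + apply supp_comb; [exact Sp|now apply supp_comb].
    + repeat rewrite ?dot_comb_l, ?dot_comb_r. rewrite Hp1, HP1, HPp, HPp'.
      transitivity ((1 - c * c) * (1 - c * c) / (s * s) + c * c); [field; lra|].
      rewrite Hsc. field. nra.
    + intros k Hk.
      pose proof (first_order n K p (comb c p s P) k c (eb_cc n K c EK) Hy Hk) as F.
      assert (c * dot n (comb c p s P) k <= dot n p k).
      { apply F; [intros u Hu; now apply (eb_dot n K c EK)|].
        rewrite dot_comb_r, Hp1, HPp'. ring. }
      rewrite dot_comb_l.
      replace (/ s * dot n p k + - c / s * dot n (comb c p s P) k)
        with ((dot n p k - c * dot n (comb c p s P) k) / s) by (field; lra).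
      apply Rle_mult_inv_pos; lra.
    + rewrite !dot_comb_r, HP1, HPp. field. lra.
  - intros Q [SQ HQ].
    pose proof (sphere_dot_bound n P Q (proj1 HP) SQ) as HdQ.
    destruct (Rlt_or_le c 0) as [Hc|Hc].
    + apply Rnot_lt_le. intros Hlt. set (d := dot n P Q) in *.
      assert (KP : K P).
      { apply (polar_ball n K c P); try assumption; [now split| |]; rewrite HP1; nra. }
      pose proof (HQ P KP) as Hd0. rewrite dot_sym in Hd0. fold d in Hd0.
      assert (Hr0 : 0 < 1 - d * d) by nra.
      set (r := sqrt (1 - d * d)).
      assert (Hr : 0 < r) by now apply sqrt_lt_R0.
      assert (Hrr : r * r = 1 - d * d) by (apply sqrt_sqrt; lra).
      destruct SQ as [SQ HQ1].
      (* Since c < 0, this x lies on the far side of P from Q, at inner product s with P. That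
         places it in K, so Q.x = s d + c r must be nonnegative, which fails for 0 <= d < - c. *)
      set (x := comb s P (c / r) (comb 1 Q (- d) P)).
      assert (HPx : dot n P x = s).
      { unfold x. rewrite !dot_comb_r, HP1. fold d. field. lra. }
      assert (Kx : K x).
      { apply (polar_ball n K c P); try assumption; [| lra |rewrite HPx; lra].
        split; [apply supp_comb; [exact SP|now apply supp_comb]|].
        unfold x. repeat rewrite ?dot_comb_l, ?dot_comb_r.
        rewrite HP1, HQ1, (dot_sym n Q P). fold d.
        transitivity (s * s + c * c * (1 - d * d) / (r * r)); [field; lra|].
        rewrite Hrr, Hsc. field. lra. }
      specialize (HQ x Kx). unfold x in HQ.
      rewrite !dot_comb_r, HQ1, (dot_sym n Q P) in HQ. fold d in HQ.
      replace (s * d + c / r * (1 * 1 + - d * d)) with (s * d + c * (r * r) / r) in HQ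
        by (rewrite Hrr; field; lra).
      replace (c * (r * r) / r) with (c * r) in HQ by (field; lra).
      assert (- c * r <= s * d) by lra.
      assert (E1 : (- c * r) * (- c * r) <= (s * d) * (s * d)) by (apply Rmult_le_compat; nra).
      assert (E2 : c * c * (1 - d * d) <= (1 - c * c) * (d * d))
        by (rewrite <- Hrr, <- Hsc; lra).
      nra.
    (* Here y = c p + s P is the test point: Q.y >= 0 together with Bessel gives d^2 <= c^2, against
       d < - c <= 0. *)
    + pose proof (HQ _ Hy) as HQy. rewrite dot_comb_r in HQy.
      pose proof (bessel n p P Q (conj Sp Hp1) (proj1 HP) SQ HPp) as HB.
      rewrite (dot_sym n Q p), (dot_sym n Q P) in HQy.
      set (d := dot n P Q) in *. set (q := dot n p Q) in *.
      apply Rnot_lt_le. intros Hlt.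
      assert (H1 : s * (- d) <= c * q) by lra.
      assert (E1 : (s * - d) * (s * - d) <= (c * q) * (c * q)).
      { apply Rmult_le_compat; try exact H1; nra. }
      assert (E2 : (1 - c * c) * (d * d) <= c * c * (1 - d * d)).
      { rewrite <- Hsc. apply Rle_trans with (c * c * (q * q)); [lra|].
        apply Rmult_le_compat_l; nra. }
      nra.
Qed.

(** * Boundary, interior, the polar body and separation *)

Lemma sph_boundary_mem n K P :
  convex_closed n K -> sph_boundary n K P -> K P.
Proof.
  intros [KS KC _] [SP HP]. apply KC; [exact SP|]. intros delta Hd.
  destruct (dot_of_sdist_lt delta Hd) as (eps & He & Hdist).
  destruct (HP eps He) as [(Q & HQ & HPQ) _]. exists Q. split; [exact HQ|].
  apply Hdist; [exact SP|now apply KS|exact HPQ].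
Qed.

(** Moving p slightly in the direction - P leaves the hemisphere of P and hence K. *)
Lemma touching_boundary n K P p :
  (forall x, K x -> sphere n x) -> K p -> polar n K P -> dot n P p = 0 ->
  sph_boundary n K p.
Proof.
  intros KS Hp [[SP HP1] HP] HPp. pose proof (KS p Hp) as Sp.
  split; [exact Sp|]. intros eps He.
  destruct (sdist_lt_of_dot eps He) as (delta & Hd & Hdist). split.
  - exists p. split; [exact Hp|]. apply Hdist; [exact Sp|exact Sp|].
    rewrite (proj2 Sp). lra.
  - destruct (ray_continuous n p P delta) as (eta & Heta & Hray);
      [rewrite (proj2 Sp); lra|exact Hd|].
    destruct (Hray (- (eta / 2))) as [HN HD]; [rewrite Rabs_left; lra|].
    set (v := comb 1 p (- (eta / 2)) P) in *.
    assert (Sv : sphere n (normal n v))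
      by (apply sphere_normal; [apply supp_comb; [exact (proj1 Sp)|exact SP]|exact HN]).
    exists (normal n v). split; [exact Sv|]. split.
    + intros HK. specialize (HP _ HK). rewrite dot_sym in HP.
      pose proof (dot_normal n v P HN) as E. pose proof (sqrt_lt_R0 _ HN).
      assert (Ev : dot n v P = - (eta / 2)).
      { unfold v. rewrite dot_comb_l, HP1, (dot_sym n p P), HPp. ring. }
      nra.
    + apply Hdist; [exact Sp|exact Sv|]. now rewrite (normal_sphere n p Sp) in HD.
Qed.

(** An interior point can be moved a little in the direction - w inside K, where the inner product
    with w is still nonnegative. *)
Lemma interior_polar_pos n K o w :
  (forall x, K x -> sphere n x) -> sph_interior_pt n K o -> polar n K w ->
  0 < dot n o w.
Proof.
  intros KS Ho [[Sw Hw1] Hw].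
  destruct (interior_ray n K o w KS Ho Sw) as (eta & He & Hray).
  destruct (cone_inv n K _ KS (Hray (- (eta / 2)) ltac:(rewrite Rabs_left; lra))) as [HN HK].
  specialize (Hw _ HK). rewrite dot_sym in Hw.
  pose proof (dot_normal n _ w HN) as E. pose proof (sqrt_lt_R0 _ HN).
  rewrite (dot_comb_l n 1 o _ w w), Hw1 in E. nra.
Qed.

(** If o.k = c, pushing o inside K directly away from k would give a pair at inner product below
    c. *)
Lemma interior_center n K o c :
  convex_closed n K -> sph_interior_pt n K o -> K o -> -1 < c < 1 ->
  (forall x y, K x -> K y -> c <= dot n x y) -> forall k, K k -> c < dot n o k.
Proof.
  intros CK Ho Ko Hc Hdiam k Hk.
  pose proof (cc_sphere n K CK) as KS.
  destruct (KS o Ko) as [So Ho1]. destruct (KS k Hk) as [Sk Hk1].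
  apply Rnot_le_lt. intros Hle.
  assert (Eok : dot n o k = c) by (apply Rle_antisym; [exact Hle|now apply Hdiam]).
  set (d := comb 1 k (- c) o).
  destruct (interior_ray n K o d KS Ho) as (eta & He & Hray); [now apply supp_comb|].
  (* With t <= 1 the norm grows by at most t (1 - c^2) / 2, too little to offset the loss t (1 -
     c^2) in the inner product with k when c < 0. *)
  set (t := Rmin (eta / 2) 1).
  assert (Ht0 : 0 < t) by (apply Rmin_glb_lt; lra).
  assert (Ht1 : t <= 1) by apply Rmin_r.
  assert (Hte : t <= eta / 2) by apply Rmin_l.
  destruct (cone_inv n K _ KS (Hray (- t) ltac:(rewrite Rabs_left; lra))) as [HN HK].
  pose proof (Hdiam _ _ HK Hk) as F.
  pose proof (dot_normal n _ k HN) as E. pose proof (sqrt_lt_R0 _ HN) as Hr.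
  pose proof (sqrt_sqrt _ (Rlt_le _ _ HN)) as Q.
  assert (EN : dot n (comb 1 o (- t) d) (comb 1 o (- t) d) = 1 + t * t * (1 - c * c)).
  { unfold d. repeat rewrite ?dot_comb_l, ?dot_comb_r.
    rewrite (dot_sym n k o), Eok, Ho1, Hk1. ring. }
  rewrite EN in *.
  assert (Ev : dot n (comb 1 o (- t) d) k = c - t * (1 - c * c)).
  { unfold d. rewrite !dot_comb_l, Eok, Hk1. ring. }
  rewrite Ev in E. set (r := sqrt (1 + t * t * (1 - c * c))) in *.
  assert (Hs : 0 < 1 - c * c) by nra.
  assert (Hrc : r * c <= c - t * (1 - c * c)).
  { rewrite <- E. apply Rmult_le_compat_l; lra. }
  assert (Hts : 0 < t * (1 - c * c)) by nra.
  assert (Hr1 : 1 <= r) by nra.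
  assert (Hr2 : r <= 1 + t * t * (1 - c * c) / 2)
    by (pose proof (Rle_0_sqr (r - 1)) as Z; unfold Rsqr in Z; lra).
  assert (- (r - 1) <= (r - 1) * c) by nra.
  assert (t * (t * (1 - c * c)) <= 1 * (t * (1 - c * c)))
    by (apply Rmult_le_compat_r; lra).
  lra.
Qed.

(** The interior point o has positive inner product with every polar point, so nonnegative
    combinations of polar points with a + b > 0 do not vanish. *)
Lemma polar_convex_closed n K o :
  (forall x, K x -> sphere n x) -> sph_interior_pt n K o ->
  convex_closed n (polar n K).
Proof.
  intros KS Ho. split.
  - now intros x [Sx _].
  - intros P SP HP. split; [exact SP|]. intros k Hk.
    apply Rnot_lt_le. intros Hlt. set (m := dot n P k) in *.
    destruct (HP (m * m / 2)) as (Q & [SQ HQ] & HPQ); [nra|].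
    specialize (HQ k Hk).
    pose proof (cauchy_schwarz n (comb 1 P (-1) Q) k) as CS.
    destruct SP as [_ HP1]. destruct SQ as [_ HQ1]. destruct (KS k Hk) as [_ Hk1].
    rewrite !dot_comb_l, !dot_comb_r, (dot_sym n Q P), HP1, HQ1, Hk1 in CS.
    fold m in CS. nra.
  - intros x y a b Hx Hy Ha Hb Hab.
    pose proof (interior_polar_pos n K o x KS Ho Hx) as Hox.
    pose proof (interior_polar_pos n K o y KS Ho Hy) as Hoy.
    destruct Hx as [[Sx _] Hx]. destruct Hy as [[Sy _] Hy].
    set (v := comb a x b y).
    assert (Hov : 0 < dot n o v) by (unfold v; rewrite dot_comb_r; destruct Ha as [Ha| <-]; nra).
    assert (HN : 0 < dot n v v).
    { pose proof (cauchy_schwarz n o v) as CS. pose proof (dot_pos n v).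
      destruct Ho as [[_ Ho1] _]. rewrite Ho1, Rmult_1_l in CS.
      assert (0 < dot n o v * dot n o v) by now apply Rmult_lt_0_compat. lra. }
    apply cone_normal with n; [exact HN|]. split.
    + apply sphere_normal; [now apply supp_comb|exact HN].
    + intros k Hk. pose proof (dot_normal n v k HN) as E.
      pose proof (sqrt_lt_R0 _ HN).
      assert (0 <= dot n v k).
      { unfold v. rewrite dot_comb_l. specialize (Hx k Hk). specialize (Hy k Hk). nra. }
      nra.
Qed.

Lemma body_convex_closed n K : sph_convex_body n K -> convex_closed n K.
Proof.
  intros ([KS KR] & KC & _). split; [exact KS| |].
  - intros P SP HP. apply KC; [exact SP|]. intros eps He.
    destruct (sdist_lt_of_dot eps He) as (delta & Hd & Hdist).
    destruct (HP delta Hd) as (Q & HQ & HPQ). exists Q. split; [exact HQ|].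
    apply Hdist; [exact SP|now apply KS|exact HPQ].
  - intros x y a b Hx Hy Ha Hb Hab.
    destruct (KR x y (a / (a + b)) (cone_mem K x Hx) (cone_mem K y Hy))
      as (l & u & Hl & Hu & E).
    { split; [now apply Rle_mult_inv_pos|].
      apply (Rmult_le_reg_r (a + b)); [exact Hab|].
      replace (a / (a + b) * (a + b)) with a by (field; lra). lra. }
    exists ((a + b) * l), u. split; [nra|]. split; [exact Hu|].
    intros i. rewrite Rmult_assoc, <- E. unfold comb. field. lra.
Qed.

Lemma convex_no_antipodes n K x y :
  convex_closed n K -> K x -> K y -> -1 < dot n x y.
Proof.
  intros [KS KC KR] Hx Hy.
  destruct (cone_inv n K (comb 1 x 1 y) KS) as [HN _]; [apply KR; try assumption; lra|].
  destruct (KS x Hx) as [_ Hx1]. destruct (KS y Hy) as [_ Hy1].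
  rewrite !dot_comb_l, !dot_comb_r, (dot_sym n y x), Hx1, Hy1 in HN. lra.
Qed.

Lemma dot_two n x y :
  (1 <= n)%nat -> (forall i, (2 <= i)%nat -> y i = 0) ->
  dot n x y = x 0%nat * y 0%nat + x 1%nat * y 1%nat.
Proof.
  intros Hn Hy. unfold dot. induction Hn as [|n Hn IH]; [simpl; ring|].
  rewrite tech5, IH, (Hy (S n)) by lia. ring.
Qed.

Lemma exists_orthogonal n o :
  (1 <= n)%nat -> exists e, supp n e /\ 0 < dot n e e /\ dot n o e = 0.
Proof.
  intros Hn.
  set (f := fun (a b : R) (i : nat) => match i with O => a | S O => b | _ => 0 end).
  assert (F0 : forall a b i, (2 <= i)%nat -> f a b i = 0).
  { intros a b [|[|i]] Hi; [lia|lia|reflexivity]. }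
  destruct (Req_dec (o 0%nat) 0) as [H0|H0].
  - exists (f 1 0). split; [intros i Hi; apply F0; lia|].
    rewrite !dot_two by (assumption || apply F0). simpl. rewrite H0. lra.
  (* The first two coordinates of o turned by a right angle; nonzero because [o 0] is. *)
  - exists (f (- o 1%nat) (o 0%nat)). split; [intros i Hi; apply F0; lia|].
    rewrite !dot_two by (assumption || apply F0). simpl. split; [nra|ring].
Qed.

Lemma interior_other_point n K o x :
  (1 <= n)%nat -> (forall x, K x -> sphere n x) -> sph_interior_pt n K o -> K o ->
  exists k, K k /\ k <> x.
Proof.
  intros Hn KS Ho Ko.
  destruct (classic (o = x)) as [<-|Hne]; [|now exists o].
  destruct (exists_orthogonal n o Hn) as (e & Se & He & Hoe).
  destruct (interior_ray n K o e KS Ho Se) as (eta & Heta & Hray).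
  destruct (cone_inv n K _ KS (Hray (eta / 2) ltac:(rewrite Rabs_right; lra))) as [HN HK].
  exists (normal n (comb 1 o (eta / 2) e)). split; [exact HK|]. intros E.
  pose proof (dot_normal n _ e HN) as E1. rewrite E, Hoe in E1.
  rewrite (dot_comb_l n 1 o _ e e), Hoe in E1. nra.
Qed.

(** The normal at the point of K nearest to x, found by [min_normal] at - x. That x is outside K and
    that K has a point other than - x give the two strict bounds needed there. *)
Lemma separation n K x :
  convex_closed n K -> (forall y, exists k, K k /\ k <> y) -> sphere n x -> ~ K x ->
  exists w, polar n K w /\ dot n w x < 0.
Proof.
  intros CK Htwo Sx Hx. pose proof (cc_sphere n K CK) as KS.
  pose proof (sphere_opp n x Sx) as Sy.
  destruct (min_normal n K (comb (-1) x 0 x) CK Sy)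
    as (p & P & Hp & HP & HPp & _ & r & Hr & Hrr & EP).
  - intros k Hk. rewrite dot_comb_l.
    pose proof (sphere_dot_bound n x k Sx (KS k Hk)).
    assert (dot n x k <> 1); [|lra]. intros E.
    apply Hx. now rewrite (sphere_dot1_eq n x k Sx (KS k Hk) E).
  - destruct (Htwo (comb (-1) x 0 x)) as (k & Hk & Hne). exists k. split; [exact Hk|].
    pose proof (sphere_dot_bound n _ k Sy (KS k Hk)).
    assert (dot n (comb (-1) x 0 x) k <> 1); [|lra]. intros E.
    apply Hne. symmetry. now apply (sphere_dot1_eq n _ k Sy (KS k Hk)).
  - exists P. split; [exact HP|].
    set (y := comb (-1) x 0 x) in *.
    assert (E1 : dot n P y = r).
    { rewrite EP, dot_comb_l, (proj2 Sy), (dot_sym n p y).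
      apply (Rmult_eq_reg_l r); [|lra]. rewrite Hrr. field. lra. }
    unfold y in E1. rewrite dot_comb_r in E1. lra.
Qed.

(** * Lunes and width in terms of the polar body *)

(** The normalized part u of P orthogonal to Q decides both claims: u and - u are on the boundary of
    the hemisphere of Q, but P.u > 0. *)
Lemma is_lune_of_dot n P Q :
  sphere n P -> sphere n Q -> -1 < dot n P Q < 1 -> is_lune n P Q.
Proof.
  intros [SP HP1] [SQ HQ1] Hd. set (d := dot n P Q) in *.
  set (v := comb 1 P (- d) Q).
  assert (HQv : dot n Q v = 0).
  { unfold v. rewrite dot_comb_r, (dot_sym n Q P), HQ1. fold d. ring. }
  assert (HPv : dot n P v = 1 - d * d).
  { unfold v. rewrite dot_comb_r, HP1. fold d. ring. }
  assert (HN : 0 < dot n v v).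
  { unfold v at 1. rewrite dot_comb_l, HPv, HQv. nra. }
  assert (Sv : sphere n (normal n v)) by (apply sphere_normal; [now apply supp_comb|exact HN]).
  pose proof (dot_normal n v P HN) as EP. pose proof (dot_normal n v Q HN) as EQ.
  rewrite (dot_sym n v P), HPv, (dot_sym n _ P) in EP.
  rewrite (dot_sym n v Q), HQv, (dot_sym n _ Q) in EQ.
  pose proof (sqrt_lt_R0 _ HN) as Hr. set (r := sqrt (dot n v v)) in *.
  set (u := normal n v) in *.
  assert (HPu : 0 < dot n P u) by nra. assert (HQu : dot n Q u = 0) by nra.
  split; intros H.
  - pose proof (sphere_opp n u Sv) as Su.
    assert (H1 : hemi n Q (comb (-1) u 0 u)) by (split; [exact Su|rewrite dot_comb_r; lra]).
    apply H in H1. destruct H1 as [_ H1]. rewrite dot_comb_r in H1. lra.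
  - assert (H1 : hemi n Q u) by (split; [exact Sv|lra]).
    apply H in H1. lra.
Qed.

(** Thickness tau means P.Q = cos (PI - tau). The polar points that form no lune with P do no harm:
    Q = P has inner product 1, and Q = - P is excluded by the interior point. *)
Lemma width_eq_polar n K o P tau :
  (forall x, K x -> sphere n x) -> sph_interior_pt n K o -> 0 < tau < PI ->
  polar n K P ->
  (width_eq n K P tau <->
   (exists Q, polar n K Q /\ dot n P Q = - cos tau) /\
   (forall Q, polar n K Q -> - cos tau <= dot n P Q)).
Proof.
  intros KS Ho Ht HP. pose proof (proj1 HP) as SP.
  assert (Hhemi : forall Q, sphere n Q ->
    ((forall R, K R -> hemi n Q R) <-> polar n K Q)).
  { intros Q SQ. split.
    - intros H. split; [exact SQ|]. intros k Hk. now apply H.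
    - intros [_ H] R HR. split; [now apply KS|now apply H]. }
  assert (Hc : cos (PI - tau) = - cos tau) by apply Rtrigo_facts.cos_pi_minus.
  pose proof (cos_strict_bound tau Ht) as Hcos.
  split.
  - intros [(Q & SQ & HL & HQ & E) Hmin]. apply Hhemi in HQ; [|exact SQ]. split.
    + exists Q. split; [exact HQ|]. rewrite <- Hc.
      apply sdist_eq_iff; try assumption; [lra|]. unfold thickness in E. lra.
    + intros R HR. pose proof (proj1 HR) as SR.
      pose proof (sphere_dot_bound n P R SP SR).
      assert (dot n P R <> -1).
      { intros Em.
        assert (ER : comb (-1) P 0 P = R).
        { apply (sphere_dot1_eq n); [now apply sphere_opp|exact SR|].
          rewrite dot_comb_l. lra. }
        pose proof (interior_polar_pos n K o P KS Ho HP).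
        pose proof (interior_polar_pos n K o R KS Ho HR) as HoR.
        rewrite <- ER, dot_comb_r in HoR. lra. }
      destruct (Req_dec (dot n P R) 1) as [E1|E1]; [lra|].
      rewrite <- Hc. apply sdist_le_iff; try assumption; [lra|].
      specialize (Hmin R SR). unfold thickness in Hmin.
      assert (tau <= PI - sdist n P R); [|lra].
      apply Hmin; [apply is_lune_of_dot; try assumption; lra|now apply Hhemi].
  - intros [(Q & HQ & E) Hmin]. pose proof (proj1 HQ) as SQ. split.
    + exists Q. split; [exact SQ|]. split; [apply is_lune_of_dot; try assumption; lra|].
      split; [now apply Hhemi|]. unfold thickness.
      rewrite <- Hc in E. apply sdist_eq_iff in E; try assumption; lra.
    + intros R SR _ HR. apply Hhemi in HR; [|exact SR].
      specialize (Hmin R HR). rewrite <- Hc in Hmin. unfold thickness.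
      apply sdist_le_iff in Hmin; try assumption; lra.
Qed.

(** * A centre for the polar body *)

(** (P + Q).R >= 2 c, whereas |P + Q| = sqrt (2 + 2 c) < 2. *)
Lemma dot_normal_sum_gt n P Q R c :
  0 < c < 1 -> sphere n P -> sphere n Q -> dot n P Q = c ->
  c <= dot n P R -> c <= dot n Q R -> c < dot n (normal n (comb 1 P 1 Q)) R.
Proof.
  intros Hc [SP HP] [SQ HQ] E HPR HQR.
  assert (EN : dot n (comb 1 P 1 Q) (comb 1 P 1 Q) = 2 + 2 * c).
  { rewrite !dot_comb_l, !dot_comb_r, (dot_sym n Q P), HP, HQ, E. ring. }
  assert (HN : 0 < dot n (comb 1 P 1 Q) (comb 1 P 1 Q)) by (rewrite EN; lra).
  pose proof (dot_normal n _ R HN) as E1. rewrite (dot_comb_l n 1 P 1 Q R) in E1.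
  pose proof (sqrt_lt_R0 _ HN) as Hr. pose proof (sqrt_sqrt _ (Rlt_le _ _ HN)) as Hrr.
  rewrite EN in *. set (r := sqrt (2 + 2 * c)) in *.
  assert (r < 2) by nra.
  apply (Rmult_lt_reg_l r); [exact Hr|]. rewrite E1. nra.
Qed.

(** Supplies [eb_center] for the polar body. For c > 0 the midpoint of a pair at inner product c
    works; for c <= 0 a point u with u.w > 0 for all polar w is enough. *)
Lemma polar_center n K o c :
  convex_closed n K -> sph_interior_pt n K o -> -1 < c < 1 ->
  (exists P Q, polar n K P /\ polar n K Q /\ dot n P Q = c) ->
  (forall P Q, polar n K P -> polar n K Q -> c <= dot n P Q) ->
  exists u, polar n K u /\ forall w, polar n K w -> c < dot n u w.
Proof.
  intros CK Ho Hc (P & Q & HP & HQ & E) Hmin.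
  pose proof (cc_sphere n K CK) as KS.
  pose proof (polar_convex_closed n K o KS Ho) as CL.
  pose proof (cc_sphere n _ CL) as LS.
  destruct (Rlt_or_le 0 c) as [Hc0|Hc0].
  - exists (normal n (comb 1 P 1 Q)). split.
    + apply (cone_inv n (polar n K)); [exact LS|]. apply CL; try assumption; lra.
    + intros w Hw. apply dot_normal_sum_gt; try (now apply LS); try lra; now apply Hmin.
  - (* the nearest point to [o] in the polar cone *)
    destruct (linear_max n (polar n K) o LS (cc_closed n _ CL)) as (u & Hu & Hmax);
      [now exists P|exact (proj1 Ho)|].
    exists u. split; [exact Hu|]. intros w Hw.
    pose proof (first_order n (polar n K) (comb (-1) o 0 o) u w (- dot n o u) CL Hu Hw) as F.
    rewrite !dot_comb_l in F.
    pose proof (interior_polar_pos n K o u KS Ho Hu).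
    pose proof (interior_polar_pos n K o w KS Ho Hw).
    assert (- dot n o u * dot n u w <= -1 * dot n o w + 0 * dot n o w).
    { apply F; [|lra]. intros v Hv. rewrite dot_comb_l. specialize (Hmax v Hv). lra. }
    assert (0 < dot n u w) by nra. lra.
Qed.

(** * The two implications *)

Lemma constant_diameter_width n K tau :
  sph_convex_body n K -> 0 < tau < PI ->
  constant_diameter n K tau -> constant_width n K tau.
Proof.
  intros BK Ht [[_ Hdiam] Hfar].
  pose proof (body_convex_closed n K BK) as CK. pose proof (cc_sphere n K CK) as KS.
  destruct BK as (_ & _ & o & Ho).
  pose proof (interior_mem n K o Ho) as Ko.
  pose proof (cos_strict_bound tau Ht) as Hcos.
  assert (Hdot : forall x y, K x -> K y -> cos tau <= dot n x y).
  { intros x y Hx Hy. apply sdist_le_iff; auto. }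
  assert (EK : extremal_body n K (cos tau)).
  { split; [exact CK|exact Hdot| |].
    - intros b Hb. destruct (Hfar b Hb) as (y & Hy & E). exists y. split; [exact Hy|].
      apply sdist_eq_iff; auto. apply Hb.
    - exists o. split; [exact Ko|]. now apply (interior_center n K o). }
  intros P SP (p & _ & HK & Hp & HPp).
  assert (HP : polar n K P) by (split; [exact SP|intros k Hk; now apply HK]).
  apply (width_eq_polar n K o P tau KS Ho Ht HP).
  apply (extremal_body_polar n K (cos tau) p P); try assumption.
  now apply sph_boundary_mem with n.
Qed.

Lemma constant_width_diameter n K tau :
  (1 <= n)%nat -> sph_convex_body n K -> 0 < tau < PI ->
  constant_width n K tau -> constant_diameter n K tau.
Proof.
  intros Hn BK Ht W.
  pose proof (body_convex_closed n K BK) as CK. pose proof (cc_sphere n K CK) as KS.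
  destruct BK as (_ & _ & o & Ho).
  pose proof (interior_mem n K o Ho) as Ko.
  pose proof (cos_strict_bound tau Ht) as Hcos.
  assert (Htwo : forall y, exists k, K k /\ k <> y)
    by (intros y; now apply (interior_other_point n K o)).
  pose proof (polar_convex_closed n K o KS Ho) as CL.
  pose proof (cc_sphere n _ CL) as LS.
  assert (Hsep : forall z, sphere n z -> ~ K z -> exists w, polar n K w /\ dot n z w < 0).
  { intros z Sz Hz. destruct (separation n K z CK Htwo Sz Hz) as (w & Hw & H).
    exists w. split; [exact Hw|]. now rewrite dot_sym. }
  assert (Hbip : forall x, polar n (polar n K) x <-> K x).
  { intros x. split.
    - intros [Sx Hx]. apply NNPP. intros HKx. destruct (Hsep x Sx HKx) as (w & Hw & H).
      specialize (Hx w Hw). lra.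
    - intros Hx. split; [now apply KS|]. intros w Hw. rewrite dot_sym. now apply Hw. }
  assert (Hwidth : forall P p, polar n K P -> K p -> dot n P p = 0 ->
    (exists Q, polar n K Q /\ dot n P Q = - cos tau) /\
    (forall Q, polar n K Q -> - cos tau <= dot n P Q)).
  { intros P p HP Hp E. apply (width_eq_polar n K o P tau KS Ho Ht HP).
    apply W; [apply HP|]. exists p. split; [apply HP|]. split.
    - intros R HR. split; [now apply KS|now apply HP].
    - split; [now apply (touching_boundary n K P p)|exact E]. }
  (* Separating - o from K shows that the polar body is nonempty; minimizing one of its points over
     K then produces a touching pair. *)
  assert (Hex : exists p P, K p /\ polar n K P /\ dot n P p = 0).
  { destruct (separation n K (comb (-1) o 0 o) CK Htwo (sphere_opp n o (KS o Ko)))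
      as (w & Hw & _).
    { intros HK. pose proof (convex_no_antipodes n K _ o CK HK Ko) as H.
      rewrite dot_comb_l, (proj2 (KS o Ko)) in H. lra. }
    pose proof (proj1 Hw) as Sw.
    destruct (min_normal n K w CK Sw) as (p & P & Hp & HP & E & _).
    - intros k Hk. pose proof (proj2 Hw k Hk). lra.
    - destruct (Htwo w) as (k & Hk & Hne). exists k. split; [exact Hk|].
      pose proof (sphere_dot_bound n w k Sw (KS k Hk)).
      assert (dot n w k <> 1); [|lra]. intros E. apply Hne. symmetry.
      now apply (sphere_dot1_eq n w k Sw (KS k Hk)).
    - now exists p, P. }
  destruct Hex as (p0 & P0 & Hp0 & HP0 & E0).
  assert (Hantip : forall P Q, polar n K P -> polar n K Q -> -1 < dot n P Q)
    by (intros P Q HP HQ; now apply (convex_no_antipodes n (polar n K))).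
  (* The polar point Q' minimizing the inner product with P has a normal x in the bipolar, that is
     in K. So the hemisphere of Q' supports K at x, and the width there bounds Q'.P. *)
  assert (Hdot : forall P Q, polar n K P -> polar n K Q -> - cos tau <= dot n P Q).
  { intros P Q HP HQ. apply Rnot_lt_le. intros Hlt.
    destruct (min_normal n (polar n K) P CL (LS P HP)) as (Q' & x & HQ' & Hx & E & Hmin & _).
    - intros k Hk. now apply Hantip.
    - exists Q. split; [exact HQ|lra].
    - destruct (Hwidth Q' x HQ') as [_ H]; [now apply Hbip|now rewrite dot_sym|].
      specialize (H P HP). rewrite dot_sym in H. specialize (Hmin Q HQ). lra. }
  assert (EL : extremal_body n (polar n K) (- cos tau)).
  { split; [exact CL|exact Hdot| |].
    - intros b Hb. pose proof (sph_boundary_mem n _ b CL Hb) as Lb.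
      destruct (boundary_touch n (polar n K) K b KS (cc_closed n K CK)) as (p & Hp & E);
        [now exists o|exact Hb|apply Lb| |].
      + intros z Sz Hz. apply NNPP. intros Hno. apply Hz. split; [exact Sz|].
        intros k Hk. apply Rnot_lt_le. intros Hlt. apply Hno. now exists k.
      + now apply (Hwidth b p).
    - apply (polar_center n K o); try assumption; [lra|].
      destruct (Hwidth P0 p0 HP0 Hp0 E0) as [(Q & HQ & EQ) _]. now exists P0, Q. }
  (* The forward argument applied to the polar body, with touching point and normal exchanged and
     the bipolar identified with K. *)
  assert (Hdiam : forall x P, K x -> polar n K P -> dot n x P = 0 ->
    (exists y, K y /\ dot n x y = cos tau) /\ (forall y, K y -> cos tau <= dot n x y)).
  { intros x P Hx HP E.
    destruct (extremal_body_polar n (polar n K) (- cos tau) P x) as [(y & Hy & Ey) H];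
      try assumption; [lra|now apply Hbip|].
    rewrite Ropp_involutive in *. split.
    - exists y. split; [now apply Hbip|exact Ey].
    - intros z Hz. apply H. now apply Hbip. }
  assert (E0' : dot n p0 P0 = 0) by now rewrite dot_sym.
  split; [split|].
  - destruct (Hdiam p0 P0 Hp0 HP0 E0') as [(y & Hy & Ey) _].
    exists p0, y. split; [exact Hp0|]. split; [exact Hy|]. apply sdist_eq_iff; auto.
  - intros x y Hx Hy. apply sdist_le_iff; auto. apply Rnot_lt_le. intros Hlt.
    (* The pair x, y itself may have no supporting hemisphere; the point p of K farthest from y
       does, and [Hdiam] applies to p. *)
    destruct (min_normal n K y CK (KS y Hy)) as (p & P & Hp & HP & E & Hmin & _).
    + intros k Hk. now apply (convex_no_antipodes n K).
    + exists x. split; [exact Hx|]. rewrite dot_sym. lra.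
    + destruct (Hdiam p P Hp HP) as [_ H]; [now rewrite dot_sym|].
      specialize (H y Hy). rewrite dot_sym in H. specialize (Hmin x Hx).
      rewrite (dot_sym n y x) in Hmin. lra.
  - intros x Hx. pose proof (sph_boundary_mem n K x CK Hx) as Kx.
    destruct (boundary_touch n K (polar n K) x LS (cc_closed n _ CL)) as (P & HP & E);
      [now exists P0|exact Hx| |exact Hsep|].
    + intros b Hb. rewrite dot_sym. now apply Hb.
    + destruct (Hdiam x P Kx HP E) as [(y & Hy & Ey) _]. exists y. split; [exact Hy|].
      apply sdist_eq_iff; auto.
Qed.

Theorem theorem1p1 (n : nat) (C : vec -> Prop) (tau : R) :
  (1 <= n)%nat ->
  sph_convex_body n C ->
  0 < tau < PI ->
  (constant_diameter n C tau <-> constant_width n C tau).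
Proof.
  intros Hn BC Ht. split.
  - now apply constant_diameter_width.
  - now apply constant_width_diameter.
Qed.
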